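(* Let $\Lambda$ be a semigroup as in the context and let $1\le k\le d$. If $(\nu,s),(\nu',s)\in A_k$, the following are equivalent: (i) $(\nu,s)\sim(\nu',s)$; (ii) $\ell_\nu^s=\ell_{\nu'}^s$ and $\nu_{|\ell_\nu^s}=\nu'_{|\ell_{\nu'}^s}$; (iii) $j_s(H^*_\nu)=j_s(H^*_{\nu'})$; (iv) $j_s(H^*_\nu)\cap j_s(H^*_{\nu'})\ne\emptyset$.
   Context: $M$ is a lattice of rank $d$, $N$ its dual lattice. $\Lambda\subset M$ is a finitely generated sub-semigroup (containing $0$) which generates $M$ as a group and such that $\sigma^\vee:=\mathbb{R}_{\ge0}\Lambda\subset M_{\mathbb{R}}$ is a strictly convex cone of dimension $d$; $\sigma\subset N_{\mathbb{R}}$ is the dual cone, $\mathring\sigma$ its interior. $e_1,\dots,e_n$ is the minimal system of generators of $\Lambda$. $Z^\Lambda:=\mathrm{Spec}\,\mathbb{C}[\Lambda]$. For $\nu\in\mathring\sigma\cap N$, $H^*_\nu$ is the set of arcs $h:\mathrm{Spec}\,\mathbb{C}[[t]]\to Z^\Lambda$ such that for every $u\in\Lambda$ the series $X^u\circ h$ is non-zero with $\mathrm{ord}_t(X^u\circ h)=\langle\nu,u\rangle$. $j_s$ is the truncation map from arcs to $s$-jets (mod $t^{s+1}$). For $1\le k\le d$, $\mathcal{J}_k=\{e_{i_1}+\cdots+e_{i_k}\mid e_{i_1}\wedge\cdots\wedge e_{i_k}\ne0,\ 1\le i_1<\cdots<i_k\le n\}$, $\mathcal{N}(\mathcal{J}_k)$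 is the convex hull of $\mathcal{J}_k+\sigma^\vee$, $\mathrm{ord}_{\mathcal{J}_k}(\nu)=\inf_{\omega\in\mathcal{N}(\mathcal{J}_k)}\langle\nu,\omega\rangle$ for $\nu\in\sigma$. The face of $\mathcal{N}(\mathcal{J}_k)$ defined by $\nu$ is $\{\omega\in\mathcal{N}(\mathcal{J}_k)\mid\langle\nu,\omega\rangle=\mathrm{ord}_{\mathcal{J}_k}(\nu)\}$. Set $\phi_1=\mathrm{ord}_{\mathcal{J}_1}$, $\phi_k=\mathrm{ord}_{\mathcal{J}_k}-\mathrm{ord}_{\mathcal{J}_{k-1}}$ for $2\le k\le d$, $\phi_{d+1}=+\infty$. $A_k:=\{(\nu,s)\mid\nu\in\mathring\sigma\cap N,\ s\in\mathbb{Z}_{>0},\ \phi_k(\nu)\le s<\phi_{k+1}(\nu)\}$. $\ell_\nu^s:=\mathrm{span}_{\mathbb{Q}}\{e_i\mid1\le i\le n,\ \langle\nu,e_i\rangle\le s\}\subset M_{\mathbb{Q}}$; $\nu_{|\ell}$ denotes the restriction to $\ell$ of the linear form $\langle\nu,\cdot\rangle$. For $(\nu,s),(\nu',s')\in A_k$, $(\nu,s)\sim(\nu',s')$ means: $s=s'$, and for all $1\le j\le k$, $\nu$ and $\nu'$ define the same face of $\mathcal{N}(\mathcal{J}_j)$ and $\mathrm{ord}_{\mathcal{J}_j}(\nu)=\mathrm{ord}_{\mathcal{J}_j}(\nu')$. *)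

(* Defs.v *)
From HB Require Import structures.
From mathcomp Require Import all_boot all_order all_algebra.
From mathcomp Require Import finmap monalg.
From mathcomp Require Import complex.
From mathcomp Require Import all_classical all_reals all_analysis.

Set Implicit Arguments.
Unset Strict Implicit.
Unset Printing Implicit Defensive.

Import Order.TTheory GRing.Theory Num.Theory.
Import numFieldNormedType.Exports.

Local Open Scope classical_set_scope.
Local Open Scope ring_scope.

(* Power series rings K[[t]]: [PowSer a] stands for sum_i (a i) t^i.  The     *)
(* record keeps the Cauchy product apart from the pointwise product that      *)
(* MathComp-Analysis puts on function types.                                  *)
Record powser (K : Type) : Type := PowSer { pscoef : nat -> K }.

HB.instance Definition _ (K : Type) := gen_eqMixin (powser K).
HB.instance Definition _ (K : Type) := gen_choiceMixin (powser K).

Notation "{ 'powser' K }" := (powser K)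
  (at level 0, K at level 2, format "{ 'powser'  K }") : type_scope.

Section PowerSeries.
Variable K : comNzRingType.
Implicit Types f g h : {powser K}.

Lemma powserP f g : (forall i, pscoef f i = pscoef g i) <-> f = g.
Proof.
split=> [|->//]; case: f => f; case: g => g /= fg.
by congr PowSer; apply/funext.
Qed.

Definition ps0 : {powser K} := PowSer (fun=> 0).
Definition ps1 : {powser K} := PowSer (fun i => (i == 0%N)%:R).
Definition psopp f : {powser K} := PowSer (fun i => - pscoef f i).
Definition psadd f g : {powser K} := PowSer (fun i => pscoef f i + pscoef g i).
Definition psscale (c : K) f : {powser K} := PowSer (fun i => c * pscoef f i).
Definition psmul f g : {powser K} :=
  PowSer (fun i => \sum_(j < i.+1) pscoef f j * pscoef g (i - j)).

Lemma psaddA : associative psadd.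
Proof. by move=> f g h; apply/powserP => i; rewrite /= addrA. Qed.
Lemma psaddC : commutative psadd.
Proof. by move=> f g; apply/powserP => i; rewrite /= addrC. Qed.
Lemma psadd0 : left_id ps0 psadd.
Proof. by move=> f; apply/powserP => i; rewrite /= add0r. Qed.
Lemma psaddN : left_inverse ps0 psopp psadd.
Proof. by move=> f; apply/powserP => i; rewrite /= addNr. Qed.

HB.instance Definition _ :=
  GRing.isZmodule.Build {powser K} psaddA psaddC psadd0 psaddN.

Definition pstrunc (n : nat) f : {poly K} := \poly_(i < n) pscoef f i.

Lemma psmul_trunc n f g i : (i < n)%N ->
  pscoef (psmul f g) i = (pstrunc n f * pstrunc n g)`_i.
Proof.
move=> ltin; rewrite coefM /=; apply: eq_bigr => j _.
rewrite !coef_poly (leq_ltn_trans (leq_subr j i) ltin).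
by rewrite (leq_ltn_trans _ ltin) // -ltnS.
Qed.

Lemma psmulC : commutative psmul.
Proof.
by move=> f g; apply/powserP => i; rewrite !(@psmul_trunc i.+1) // mulrC.
Qed.

Lemma coefM_low (p p' q : {poly K}) i :
  (forall j, (j <= i)%N -> p`_j = p'`_j) -> (p * q)`_i = (p' * q)`_i.
Proof.
by move=> pp'; rewrite !coefM; apply: eq_bigr => j _; rewrite pp' // -ltnS.
Qed.

Lemma psmulA : associative psmul.
Proof.
move=> f g h; apply/powserP => i.
rewrite ![LHS](@psmul_trunc i.+1) // ![RHS](@psmul_trunc i.+1) //.
have E u v j : (j <= i)%N ->
    (pstrunc i.+1 (psmul u v))`_j = (pstrunc i.+1 u * pstrunc i.+1 v)`_j.
  by move=> ji; rewrite coef_poly ltnS ji (@psmul_trunc i.+1).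
rewrite [RHS](coefM_low _ (E f g)) mulrC (coefM_low _ (E g h)).
by rewrite mulrC mulrA.
Qed.

Lemma psmul1 : left_id ps1 psmul.
Proof.
move=> f; apply/powserP => i /=.
rewrite big_ord_recl /= mul1r subn0 big1 ?addr0 // => j _.
by rewrite mul0r.
Qed.

Lemma psmulDl : left_distributive psmul +%R.
Proof.
move=> f g h; apply/powserP => i /=.
by rewrite -big_split /=; apply: eq_bigr => j _; rewrite mulrDl.
Qed.

Lemma ps1_neq0 : ps1 != 0.
Proof.
apply/eqP => /powserP/(_ 0%N)/= /eqP.
by rewrite oner_eq0.
Qed.

HB.instance Definition _ := GRing.Zmodule_isComNzRing.Build {powser K}
  psmulA psmulC psmul1 psmulDl ps1_neq0.

Lemma psscaleA a b f : psscale a (psscale b f) = psscale (a * b) f.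
Proof. by apply/powserP => i /=; rewrite mulrA. Qed.
Lemma psscale1 : left_id 1 psscale.
Proof. by move=> f; apply/powserP => i /=; rewrite mul1r. Qed.
Lemma psscaleDr : right_distributive psscale +%R.
Proof. by move=> a f g; apply/powserP => i /=; rewrite mulrDr. Qed.
Lemma psscaleDl f : {morph psscale^~ f : a b / a + b}.
Proof. by move=> a b; apply/powserP => i /=; rewrite mulrDl. Qed.

HB.instance Definition _ := GRing.Zmodule_isLmodule.Build K {powser K}
  psscaleA psscale1 psscaleDr psscaleDl.

Lemma psscaleAl (a : K) f g : a *: (f * g) = (a *: f) * g.
Proof.
apply/powserP => i /=; rewrite mulr_sumr.
by apply: eq_bigr => j _; rewrite mulrA.
Qed.

HB.instance Definition _ := GRing.Lmodule_isLalgebra.Build K {powser K}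
  psscaleAl.
HB.instance Definition _ := GRing.Lalgebra_isComAlgebra.Build K {powser K}.

(* The t-adic order; the value 0 at the zero series is a dummy. *)
Definition ordt f : nat :=
  if pselect (exists i, pscoef f i != 0) is left nzf then ex_minn nzf else 0%N.

(* The reduction K[[t]] -> K[t]/(t^(s+1)), a K-algebra morphism. *)
Definition psmod (s : nat) f : {poly %/ ('X^(s.+1) : {poly K})} :=
  in_qpoly 'X^(s.+1) (pstrunc s.+1 f).

Lemma psmod_is_linear s : linear (psmod s).
Proof.
move=> a f g; rewrite /psmod -linearP; congr in_qpoly.
apply/polyP => i; rewrite coefD coefZ !coef_poly.
by case: ifP => // _; rewrite mulr0 addr0.
Qed.

HB.instance Definition _ s := GRing.isLinear.Build K {powser K}
  {poly %/ ('X^(s.+1) : {poly K})} _ (psmod s) (psmod_is_linear s).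

Lemma psmod_is_monoid_morphism s : monoid_morphism (psmod s).
Proof.
split=> [|f g]; rewrite /psmod.
  rewrite -[RHS]in_qpoly1; congr in_qpoly.
  apply/polyP => i; rewrite coef_poly coef1 /=.
  by case: ltnP => //; case: i.
rewrite -in_qpolyM; apply/val_inj => /=; rewrite mk_monic_Xn /=.
rewrite -!Pdiv.RingMonic.take_poly_rmodp; apply/polyP => i.
rewrite !coef_take_poly; case: ltnP => // ilt.
by rewrite coef_poly ilt (@psmul_trunc s.+1).
Qed.

HB.instance Definition _ s := GRing.isMonoidMorphism.Build {powser K}
  {poly %/ ('X^(s.+1) : {poly K})} (psmod s) (psmod_is_monoid_morphism s).
End PowerSeries.

(* The algebra K[S] of a commutative monoid S (written additively): finitely  *)
(* supported functions on S with the convolution product.  The ring structure *)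
(* that [monalg] puts on {malg K[_]} needs a monoid without units other than  *)
(* the identity, so the product is defined here on an alias.                  *)
Definition sgalg (S : nmodType) (K : comNzRingType) : Type := {malg K[S]}.

HB.instance Definition _ S K := GRing.Lmodule.copy (sgalg S K) {malg K[S]}.

Section SemigroupAlgebra.
Variables (S : nmodType) (K : comNzRingType).
Local Notation A := (sgalg S K).
Implicit Types (g : {malg K[S]}) (u v : S).

(* The basis element X^u. *)
Definition sgX u : A := mkmalgU u 1.

Local Notation term g1 g2 := (fun u v => mkmalgU (u + v)%R (g1@_u * g2@_v)).

Definition sgmul g1 g2 : {malg K[S]} :=
  \sum_(u <- msupp g1) \sum_(v <- msupp g2) term g1 g2 u v.

Lemma sgmulw (d1 d2 : {fset S}) g1 g2 :
  fsubset (msupp g1) d1 -> fsubset (msupp g2) d2 ->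
  sgmul g1 g2 = \sum_(u <- d1) \sum_(v <- d2) term g1 g2 u v.
Proof.
move=> le1 le2; rewrite /sgmul (big_fset_incl _ le1) /=.
  apply/eq_bigr => u _; apply/big_fset_incl => // v _ /mcoeff_outdom ->.
  by rewrite mulr0 monalgU0.
move=> u _ /mcoeff_outdom g1u.
by rewrite big1 => // v _; rewrite g1u mul0r monalgU0.
Qed.

Lemma sgmulC : commutative sgmul.
Proof.
move=> g1 g2; rewrite /sgmul exchange_big /=.
by apply: eq_bigr => u _; apply: eq_bigr => v _; rewrite mulrC addrC.
Qed.

Lemma sgmul0 g : sgmul 0 g = 0.
Proof. by rewrite /sgmul msupp0 big_seq_fset0. Qed.

Lemma sgmulDl : left_distributive sgmul +%R.
Proof.
move=> g1 g2 g; have le := fsubset_refl (msupp g).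
rewrite (sgmulw (msuppD_le g1 g2) le).
rewrite (sgmulw (fsubsetUl (msupp g1) (msupp g2)) le).
rewrite (sgmulw (fsubsetUr (msupp g1) (msupp g2)) le).
rewrite -big_split /=; apply/eq_bigr => u _.
rewrite -big_split /=; apply/eq_bigr => v _.
by rewrite mcoeffD mulrDl monalgUD.
Qed.

Lemma sgmulDr : right_distributive sgmul +%R.
Proof. by move=> g g1 g2; rewrite !(sgmulC g) sgmulDl. Qed.

Lemma sgmulUU u v (a b : K) :
  sgmul (mkmalgU u a) (mkmalgU v b) = mkmalgU (u + v)%R (a * b).
Proof. by rewrite (sgmulw msuppU_le msuppU_le) !big_seq_fset1 !mcoeffUU. Qed.

Lemma sgmul_suml (I : Type) (r : seq I) (F : I -> {malg K[S]}) g :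
  sgmul (\sum_(i <- r) F i) g = \sum_(i <- r) sgmul (F i) g.
Proof. exact: (big_morph (sgmul^~ g) (fun _ _ => sgmulDl _ _ _) (sgmul0 g)). Qed.

Lemma sgmul_sumr (I : Type) (r : seq I) (F : I -> {malg K[S]}) g :
  sgmul g (\sum_(i <- r) F i) = \sum_(i <- r) sgmul g (F i).
Proof. by rewrite sgmulC sgmul_suml; apply: eq_bigr => i _; rewrite sgmulC. Qed.

Lemma sgmulA : associative sgmul.
Proof.
move=> g1 g2 g3; rewrite (monalgE g1) !sgmul_suml; apply: eq_bigr => u _.
rewrite (monalgE g2) sgmul_suml !sgmul_sumr sgmul_suml; apply: eq_bigr => v _.
rewrite (monalgE g3) !sgmul_sumr; apply: eq_bigr => w _.
by rewrite !sgmulUU mulrA addrA.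
Qed.

Lemma sgmul1 : left_id (sgX 0) sgmul.
Proof.
move=> g; rewrite (monalgE g) sgmul_sumr; apply: eq_bigr => u _.
by rewrite sgmulUU mul1r add0r.
Qed.

Lemma sgX0_neq0 : sgX 0 != 0.
Proof. by rewrite /sgX monalgU_eq0 oner_eq0. Qed.

HB.instance Definition _ := GRing.Zmodule_isComNzRing.Build A
  sgmulA sgmulC sgmul1 sgmulDl sgX0_neq0.

Lemma sgscaleU (c a : K) u :
  c *: mkmalgU u a = mkmalgU u (c * a) :> {malg K[S]}.
Proof. by apply/malgP => v; rewrite mcoeffZ !mcoeffU mulrnAr. Qed.

Lemma sgscaleAl (c : K) (g1 g2 : A) : c *: (g1 * g2) = (c *: g1) * g2.
Proof.
change (c *: sgmul g1 g2 = sgmul (c *: (g1 : {malg K[S]})) g2).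
rewrite (monalgE g1) sgmul_suml !scaler_sumr sgmul_suml.
apply: eq_bigr => u _; rewrite (monalgE g2) !sgmul_sumr scaler_sumr.
by apply: eq_bigr => v _; rewrite sgscaleU !sgmulUU sgscaleU mulrA.
Qed.

HB.instance Definition _ := GRing.Lmodule_isLalgebra.Build K A sgscaleAl.
HB.instance Definition _ := GRing.Lalgebra_isComAlgebra.Build K A.

Lemma sgXD u v : sgX (u + v) = sgX u * sgX v.
Proof. by rewrite -[RHS]/(sgmul _ _) sgmulUU mulr1. Qed.

Lemma sgX0 : sgX 0 = 1. Proof. by []. Qed.
End SemigroupAlgebra.

(* Coordinates: M = 'rV[int]_d and N = 'cV[int]_d, paired by the matrix       *)
(* product; the real and rational extensions of M and N have the same shape.  *)
Definition pairing (K : pzRingType) d (nu : 'cV[K]_d) (u : 'rV[K]_d) : K :=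
  (u *m nu) 0 0.

Definition toReal (R : realType) m n (A : 'M[int]_(m, n)) : 'M[R]_(m, n) :=
  map_mx intr A.
Arguments toReal R {m n} A.
Definition toRat m n (A : 'M[int]_(m, n)) : 'M[rat]_(m, n) := map_mx intr A.

Section Convexity.
Variables (R : realType) (d : nat).
Implicit Types C : set 'rV[R]_d.

Definition conv_hull C : set 'rV[R]_d :=
  smallest (@convex_set R 'rV[R]_d) C.

Definition minkowski_sum C D : set 'rV[R]_d :=
  [set w | exists x y, [/\ C x, D y & w = x + y]].

Definition strictly_convex C := forall w, C w -> C (- w) -> w = 0.

(* r is the dimension of the linear span of C. *)
Definition cone_dim C (r : nat) :=
  exists V : {vspace 'rV[R]_d},
    [/\ forall w, C w -> w \in V,
        forall W : {vspace 'rV[R]_d}, (forall w, C w -> w \in W) -> (V <= W)%VS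
      & \dim V = r].

Definition dual_cone C : set 'cV[R]_d :=
  [set nu | forall w, C w -> 0 <= pairing nu w].
End Convexity.

Section Semigroup.
Variables (d : nat) (Lam : addrClosed 'rV[int]_d).

Record semigroup : predArgType := Semigroup {
  semigroup_val :> 'rV[int]_d;
  semigroup_valP : semigroup_val \in Lam
}.

HB.instance Definition _ := [isSub for semigroup_val].
HB.instance Definition _ := [Choice of semigroup by <:].

Lemma semigroup_closed : addr_closed [pred u | u \in Lam].
Proof.
by split=> [|u v]; rewrite !inE; [exact: rpred0 | exact: rpredD].
Qed.

HB.instance Definition _ := GRing.SubChoice_isSubNmodule.Build
  'rV[int]_d [pred u | u \in Lam] semigroup semigroup_closed.

Definition generated_by n (e : 'I_n -> 'rV[int]_d) (J : {set 'I_n}) :=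
  forall u, u \in Lam <-> exists c : 'I_n -> nat, u = \sum_(i in J) e i *+ c i.

Definition finitely_generated :=
  exists n (e : 'I_n -> 'rV[int]_d), generated_by e [set: 'I_n]%SET.

Definition generates_lattice := forall G : zmodClosed 'rV[int]_d,
  {subset Lam <= G} -> forall u, u \in G.

Definition minimal_generators n (e : 'I_n -> 'rV[int]_d) :=
  generated_by e [set: 'I_n]%SET /\
  forall J : {set 'I_n}, generated_by e J -> J = [set: 'I_n]%SET.

(* The cone generated by Lam over the nonnegative reals. *)
Definition cone_of (R : realType) : set 'rV[R]_d :=
  [set w | exists (m : nat) (c : 'I_m -> R) (u : 'I_m -> semigroup),
     (forall i, 0 <= c i) /\ w = \sum_i c i *: toReal R (u i)].

Arguments cone_of : clear implicits.

(* d is the rank of M. *)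
Definition admissible_semigroup (R : realType) := [/\ finitely_generated,
  generates_lattice, strictly_convex (cone_of R) & cone_dim (cone_of R) d].

Definition sigma (R : realType) : set 'cV[R]_d := dual_cone (cone_of R).

Arguments sigma : clear implicits.

Definition sigma_interior_lattice (R : realType) : set 'cV[int]_d :=
  [set nu | (sigma R)° (toReal R nu)].
End Semigroup.
Arguments cone_of {d} Lam R _.
Arguments sigma {d} Lam R _.
Arguments sigma_interior_lattice {d} Lam R _.

Section Arcs.
Variables (R : realType) (d : nat) (Lam : addrClosed 'rV[int]_d).

(* Arcs Spec C[[t]] -> Spec C[Lam] and s-jets Spec C[t]/(t^(s+1)) ->          *)
(* Spec C[Lam], as the corresponding morphisms of C-algebras.  Composing      *)
(* X^u with an arc h is evaluating h at X^u.                                  *)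
Definition toric_arc := {lrmorphism sgalg (semigroup Lam) R[i] -> {powser R[i]}}.
Definition toric_jet (s : nat) :=
  {lrmorphism sgalg (semigroup Lam) R[i] ->
    {poly %/ ('X^(s.+1) : {poly R[i]})}}.

Definition jet_of_arc (s : nat) (h : toric_arc) : toric_jet s := psmod s \o h.

Definition Hstar (nu : 'cV[int]_d) : set toric_arc :=
  [set h | forall u : semigroup Lam, h (sgX _ u) != 0 /\
     (ordt (h (sgX _ u)))%:Z = pairing nu (u : 'rV[int]_d)].
End Arcs.
Arguments jet_of_arc {R d} Lam s h.
Arguments Hstar R {d} Lam nu _.

Section LogarithmicJacobian.
Variables (R : realType) (d : nat) (Lam : addrClosed 'rV[int]_d).
Variables (n : nat) (e : 'I_n -> 'rV[int]_d).

(* v_1 /\ ... /\ v_k, through the embedding of the exterior power of the free *)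
(* module M in its tensor power that sends it to the sum over all             *)
(* permutations p of sgn(p) v_p(1) (x) ... (x) v_p(k): the entry at f is the  *)
(* coordinate on eps_f(1) (x) ... (x) eps_f(k), for eps the standard basis.   *)
Definition wedge k (v : 'I_k -> 'rV[int]_d) : {ffun {ffun 'I_k -> 'I_d} -> int}
  := [ffun f : {ffun 'I_k -> 'I_d} => \det (\matrix_(a, b) v a 0 (f b))].

Definition Jset (k : nat) : set 'rV[int]_d :=
  [set w | exists i : 'I_k -> 'I_n,
     [/\ {homo i : a b / (a < b)%N}, wedge (e \o i) != 0
       & w = \sum_a e (i a)]].

Definition newton (k : nat) : set 'rV[R]_d :=
  conv_hull (minkowski_sum (toReal R @` Jset k) (cone_of Lam R)).

(* Only used on sigma, where the infimum is over a nonempty set bounded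
   below. *)
Definition ordJ (k : nat) (nu : 'cV[R]_d) : R :=
  inf [set pairing nu w | w in newton k].

Definition face (k : nat) (nu : 'cV[R]_d) : set 'rV[R]_d :=
  [set w | newton k w /\ pairing nu w = ordJ k nu].

Definition phi (k : nat) (nu : 'cV[R]_d) : \bar R :=
  if k == d.+1 then +oo%E
  else if k == 1%N then (ordJ 1 nu)%:E
  else (ordJ k nu - ordJ k.-1 nu)%:E.

Definition Aset (k : nat) : set ('cV[int]_d * nat) :=
  [set p | [/\ sigma_interior_lattice Lam R p.1, (0 < p.2)%N,
     (phi k (toReal R p.1) <= (p.2%:R)%:E)%E
   & ((p.2%:R)%:E < phi k.+1 (toReal R p.1))%E]].

Definition equivA (k : nat) (p q : 'cV[int]_d * nat) :=
  p.2 = q.2 /\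
  forall j, (1 <= j <= k)%N ->
    face j (toReal R p.1) = face j (toReal R q.1) /\
    ordJ j (toReal R p.1) = ordJ j (toReal R q.1).

Definition ell (nu : 'cV[int]_d) (s : nat) : {vspace 'rV[rat]_d} :=
  <<[seq toRat (e i) | i <- enum 'I_n & (pairing nu (e i) <= s%:Z)%R]>>%VS.
End LogarithmicJacobian.
Arguments Aset R {d} Lam {n} e k _.
Arguments equivA R {d} Lam {n} e k p q.

(* Main.v *)
Require Import Defs.
From HB Require Import structures.
From mathcomp Require Import all_boot all_order all_algebra.
From mathcomp Require Import finmap monalg.
From mathcomp Require Import complex.
From mathcomp Require Import all_classical all_reals all_analysis.
From mathcomp Require Import zify.

Set Implicit Arguments.
Unset Strict Implicit.
Unset Printing Implicit Defensive.

Import Order.TTheory GRing.Theory Num.Theory.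
Import numFieldNormedType.Exports.

Local Open Scope classical_set_scope.
Local Open Scope ring_scope.

(** Write [w i] and [w' i] for the values of [nu] and [nu'] on the generator
    [e i].  All four conditions are compared with one elementary condition,
    [agree_upto w w' s]: every generator of weight at most [s] for one of the
    two forms has the same weight for the other.

    Combinatorial side.  By [JsetP] and [ordJ_eq], the number [ordJ j nu] is the
    least [w]-weight of [j] linearly independent generators, so it is computed
    by the greedy algorithm of the linear matroid of the [e i].  Consequently
    [phi k nu] is the weight of the [k]-th greedy choice.  If [(nu, s)] lies in
    [A_k], the first [k] greedy choices have weight at most [s] and span every
    generator of weight at most [s]: they form a basis of [ell e nu s]
    ([Aset_greedy], [ell_greedy]).

    From (i) to (ii): the first [j] greedy choices for [nu] sum to a point of
    the face of [nu], hence of the face of [nu'], and the equality of orders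
    gives [w = w'] on each greedy choice, by differences.  These choices thus
    have weight at most [s] for [nu'] as well, and by dimension they form a
    basis of both [ell e nu s] and [ell e nu' s].

    From (ii) to (iii): an arc of [Hstar nu] sends [X^u] to [t^<nu, u>] times a
    unit [eta u] that is multiplicative in [u].  Then [t^<nu', u> * eta u]
    defines an arc of [Hstar nu'].  On a generator the two arcs are equal if the
    weight is at most [s], and both vanish modulo [t^(s+1)] otherwise, so their
    [s]-jets coincide ([jets_sub]).

    From (iii) to (iv): [Hstar nu] contains the arc [X^u |-> t^<nu, u>].

    From (iv) to (i): a power series of order at most [s] has its order
    determined by its [s]-jet, so [agree_upto w w' s] holds ([agree_of_jets]).
    By exchange with greedy choices, every minimal independent [j]-set with
    [j <= k] has all its weights at most [s]; so [nu] and [nu'] have the same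
    minimal sets and the same orders.  The faces are compared by a single
    half-space containing the Newton polyhedron ([face_sub_of_agree]). *)

(** * The greedy algorithm in a vector configuration *)

Section Greedy.
Variables (K : fieldType) (vT : vectType K) (I : finType) (v : I -> vT).
Implicit Types (w : I -> int) (f g : seq I).

Definition indep f := free (map v f).

Definition spanned f : {vspace vT} := <<map v f>>%VS.

Lemma indep_cons i f : indep (i :: f) = (v i \notin spanned f) && indep f.
Proof. exact: free_cons. Qed.

Lemma indep_rem f i : i \in f -> indep f -> indep (i :: rem i f).
Proof.
by move=> fi; rewrite /indep (perm_free (perm_map v (perm_to_rem fi))).
Qed.

Lemma indep_exchange f g : indep g -> (size f < size g)%N ->
  exists2 i, i \in g & v i \notin spanned f.
Proof.
move=> /eqP; rewrite size_map => dimg ltfg.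
apply/hasP; apply: contraTT ltfg => /hasPn gf; rewrite -leqNgt -dimg.
rewrite -(size_map v f); apply: leq_trans (dim_span _); apply: dimvS.
by apply/span_subvP => _ /mapP[i /gf gi ->]; rewrite negbK in gi.
Qed.

(** The last choice is the head of the list, so that the first [j] choices form
    a suffix [drop _ g], and [free_cons] applies directly. *)
Fixpoint greedy w g : Prop :=
  if g is i :: g' then
    [/\ v i \notin spanned g',
        forall j, v j \notin spanned g' -> w i <= w j & greedy w g']
  else True.

Lemma greedy_indep w g : greedy w g -> indep g.
Proof.
elim: g => [_|i g IH /= [gi _ /IH]]; first by rewrite /indep nil_free.
by rewrite indep_cons gi.
Qed.

Lemma dim_spanned g : indep g -> \dim (spanned g) = size g.
Proof. by move/eqP; rewrite size_map. Qed.

Lemma greedy_drop w j g : greedy w g -> greedy w (drop j g).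
Proof. by elim: g j => [|i g IH] [|j] //= [_ _ /IH]; apply. Qed.

Lemma exists_greedy w m : (m <= \dim (spanned (enum I)))%N ->
  exists2 g, greedy w g & size g = m.
Proof.
elim: m => [_|m IH ltm]; first by exists [::].
have [g gg sg] := IH (ltnW ltm).
have [i gi] : exists i, v i \notin spanned g.
  apply/existsP; apply: contraTT ltm; rewrite negb_exists => /forallP gI.
  rewrite -leqNgt -sg -(dim_spanned (greedy_indep gg)); apply: dimvS.
  by apply/span_subvP => _ /mapP[j _ ->]; have := gI j; rewrite negbK.
have [j gj jmin] := arg_minP (P := fun j => v j \notin spanned g) w gi.
by exists (j :: g) => /=; rewrite ?sg.
Qed.

(** Remove from [f] an element [m] of maximal weight and compare the rest with
    the earlier choices by induction.  Some [j] in [f] is not spanned by the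
    earlier choices, so the last choice weighs at most [w j <= w m]. *)
Lemma greedy_min w f g : greedy w g -> indep f -> size f = size g ->
  \sum_(i <- g) w i <= \sum_(i <- f) w i.
Proof.
elim: g f => [f _ _ /size0nil ->|i g IH f [gi imin gg] ff sf] //.
have [j fj gj] : exists2 j, j \in f & v j \notin spanned g.
  by apply: indep_exchange ff _; rewrite sf.
have [m fm mmax] : exists2 m, m \in f & {in f, forall x, w x <= w m}.
  have [m fm mmax] := arg_maxP (P := fun x => x \in f) w fj.
  by exists m => // x; apply: mmax.
have := indep_rem fm ff; rewrite indep_cons => /andP[_ fr].
rewrite (perm_big _ (perm_to_rem fm)) /= !big_cons lerD //.
  exact: le_trans (imin _ gj) (mmax _ fj).
by apply: IH; rewrite // size_rem // sf.
Qed.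

(** An element rejected in favour of an earlier choice was still available: what
    is not spanned by more vectors is not spanned by fewer. *)
Lemma greedy_head_max w i g : greedy w (i :: g) -> {in g, forall j, w j <= w i}.
Proof.
elim: g i => [|x g IH] i [] //= gi _ [gx xmin gg] j.
have wxi : w x <= w i.
  apply: xmin; apply: contraNN gi; apply/subvP/sub_span => y.
  by rewrite inE => ->; rewrite orbT.
rewrite inE => /predU1P[->//|gj].
by apply: le_trans wxi; apply: IH.
Qed.

(** Every minimal independent set obeys the bounds of a greedy one: an element
    [i] of [f] can be exchanged with some element [j] of [g], and minimality
    forces [w i <= w j]. *)
Lemma greedy_min_bound w c f g :
  greedy w g -> {in g, forall i, w i <= c} -> indep f -> size f = size g ->
  \sum_(i <- f) w i = \sum_(i <- g) w i -> {in f, forall i, w i <= c}.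
Proof.
move=> gg gc ff sf sumf i fi.
have szr : size (rem i f) = (size g).-1 by rewrite size_rem // sf.
have g0 : (0 < size g)%N by rewrite -sf; case: f fi {ff sf sumf szr}.
have [j gj rj] : exists2 j, j \in g & v j \notin spanned (rem i f).
  by apply: indep_exchange (greedy_indep gg) _; rewrite szr prednK.
have := indep_rem fi ff; rewrite indep_cons => /andP[_ fr].
have := @greedy_min w (j :: rem i f) g gg.
rewrite indep_cons rj fr /= szr prednK // -sumf => /(_ isT erefl).
rewrite (perm_big _ (perm_to_rem fi)) /= !big_cons lerD2r => wij.
exact: le_trans wij (gc _ gj).
Qed.

(** Consecutive differences of the partial sums recover the single weights. *)
Lemma eq_in_of_sum_drop w w' g :
  (forall j, \sum_(i <- drop j g) w i = \sum_(i <- drop j g) w' i) ->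
  {in g, w =1 w'}.
Proof.
elim: g => [//|x g IH] sums i.
have := sums 0%N; rewrite drop0 !big_cons.
have := sums 1%N; rewrite /= drop0 => -> /addIr wx.
rewrite inE => /predU1P[->//|]; apply: IH => j; exact: sums j.+1.
Qed.
End Greedy.

(** Both sides say that the [k x d] matrix of the vectors has full row rank: the
    entries of the wedge are its [k x k] minors, and a matrix of rank [k] has an
    invertible [k x k] submatrix. *)
Lemma wedge_free d n (e : 'I_n -> 'rV[int]_d) k (i : 'I_k -> 'I_n) :
  (wedge (e \o i) != 0) = free [seq toRat (e (i a)) | a <- enum 'I_k].
Proof.
pose A := \matrix_a toRat (e (i a)) : 'M[rat]_(k, d).
pose minor (f : 'I_k -> 'I_d) := \matrix_(a, b) e (i a) 0 (f b).
have minorE f : map_mx intr (minor f) = colsub f A.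
  by apply/matrixP => a b; rewrite !mxE.
have -> : free [seq toRat (e (i a)) | a <- enum 'I_k] = row_free A.
  pose X : k.-tuple _ := [tuple toRat (e (i a)) | a < k].
  have XE : free X = free [seq toRat (e (i a)) | a <- enum 'I_k].
    by congr free; rewrite -val_enum_ord -map_comp /=.
  have rowE (a : 'I_k) : X`_a = row a A by rewrite rowK -tnth_nth tnth_mktuple.
  rewrite -XE -kermx_eq0; apply/freeP/eqP => [fX|kA c].
    apply/row_matrixP => j; rewrite row0; apply/rowP => a; rewrite [RHS]mxE.
    apply: (fX (row j (kermx A) 0)); under eq_bigr do rewrite rowE.
    by rewrite -mulmx_sum_row; apply/sub_kermxP; rewrite row_sub.
  under eq_bigr do rewrite rowE; move=> cA.
  have : (\row_a c a <= kermx A)%MS.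
    apply/sub_kermxP; rewrite mulmx_sum_row -[RHS]cA.
    by apply: eq_bigr => a _; rewrite mxE.
  by rewrite kA submx0 => /eqP/rowP c0 a; have := c0 a; rewrite !mxE.
apply/idP/idP => [|fA].
  apply: contraNT => nfA; apply/eqP/ffunP => f; rewrite !ffunE.
  apply/eqP; rewrite -(intr_eq0 rat) -det_map_mx (minorE f).
  apply: contraR nfA; rewrite -unitfE -unitmxE -row_free_unit => rf.
  rewrite /row_free eqn_leq rank_leq_row.
  move: rf; rewrite /row_free => /eqP {1}<-.
  have -> : colsub f A = A *m colsub f 1%:M by rewrite mulmx_colsub mulmx1.
  exact: mxrankM_maxl.
have fA' : row_full A^T by rewrite /row_full mxrank_tr.
have := fullrowsub_unit fA'; set F := fullrankfun fA' => uF.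
apply: contraTneq uF => w0.
have := congr1 (fun w : {ffun _} => w (finfun F)) w0.
rewrite !ffunE => /(congr1 (fun x : int => x%:~R : rat)).
rewrite -det_map_mx (_ : map_mx _ _ = (rowsub F A^T)^T).
  by rewrite det_tr => d0; rewrite unitmxE d0 unitr0.
by apply/matrixP => a b; rewrite !mxE /= ffunE.
Qed.

(** * Orders and truncations of power series *)

Section PowerSeriesOrder.
Variable K : fieldType.
Implicit Types f g : {powser K}.

(** The monomial [t^m]. *)
Definition psXn m : {powser K} := PowSer (fun i => (i == m)%:R).

(** Division by [t^m], discarding the terms of degree less than [m]. *)
Definition psdrop m f : {powser K} := PowSer (fun i => pscoef f (i + m)).

Lemma coef_psXnM m f i :
  pscoef (psXn m * f) i = if (m <= i)%N then pscoef f (i - m) else 0.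
Proof.
rewrite /= ; case: leqP => [mi|im].
  have mi1 : (m < i.+1)%N by [].
  rewrite (bigD1 (Ordinal mi1)) //= eqxx mul1r big1 ?addr0 // => j.
  by rewrite -val_eqE /= => /negPf ->; rewrite mul0r.
apply: big1 => j _; rewrite -[X in (_ == X)]/m ltn_eqF ?mul0r //.
by apply: leq_ltn_trans im; rewrite -ltnS.
Qed.

Lemma psXnK m : cancel ( *%R (psXn m)) (psdrop m).
Proof.
move=> f; apply/powserP => i; rewrite /psdrop; cbn [pscoef].
by rewrite coef_psXnM leq_addl addnK.
Qed.

Lemma psXn0 : psXn 0 = 1.
Proof. exact/powserP. Qed.

Lemma psXnD m p : psXn (m + p) = psXn m * psXn p.
Proof.
apply/powserP => i; rewrite coef_psXnM /=.
case: leqP => [mi|im]; first by rewrite -{1}(subnKC mi) eqn_add2l.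
by rewrite ltn_eqF // ltn_addr.
Qed.

Lemma ordtP f : f != 0 ->
  pscoef f (ordt f) != 0 /\ forall i, (i < ordt f)%N -> pscoef f i = 0.
Proof.
move=> f0; rewrite /ordt; case: pselect => [ex|nex]; last first.
  case/eqP: f0; apply/powserP => i; apply/eqP/negPn/negP => fi.
  by apply: nex; exists i.
case: ex_minnP => m fm mmin; split=> // i; apply: contraTeq => fi.
by rewrite -leqNgt mmin.
Qed.

Lemma ordt_eq f m :
  pscoef f m != 0 -> (forall i, (i < m)%N -> pscoef f i = 0) ->
  f != 0 /\ ordt f = m.
Proof.
move=> fm flt; have f0 : f != 0 by apply: contraNneq fm => ->.
split=> //; have [fo olt] := ordtP f0.
apply/eqP; rewrite eqn_leq; apply/andP; split.
  by rewrite leqNgt; apply: contraNN fm => /olt ->.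
by rewrite leqNgt; apply: contraNN fo => /flt ->.
Qed.

Lemma psXn_psdrop f : f != 0 -> psXn (ordt f) * psdrop (ordt f) f = f.
Proof.
move=> /ordtP[_ olt]; apply/powserP => i; rewrite coef_psXnM.
by case: leqP => [oi|/olt->//]; rewrite /= subnK.
Qed.

Lemma ordt_psXnM m f : pscoef f 0 != 0 ->
  psXn m * f != 0 /\ ordt (psXn m * f) = m.
Proof.
move=> f0; apply: ordt_eq => [|i im]; rewrite coef_psXnM.
  by rewrite leqnn subnn.
by rewrite leqNgt im.
Qed.

Lemma psmod_eqP s f g :
  psmod s f = psmod s g <-> forall i, (i <= s)%N -> pscoef f i = pscoef g i.
Proof.
have val_psmod (h : {powser K}) : val (psmod s h) = pstrunc s.+1 h.
  rewrite /psmod /= mk_monic_Xn /= -Pdiv.RingMonic.take_poly_rmodp.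
  by rewrite take_poly_id // size_poly.
split=> [fg i si|fg]; last first.
  apply/val_inj; rewrite !val_psmod; apply/polyP => i; rewrite !coef_poly ltnS.
  by case: leqP => // /fg.
move/(congr1 val): fg; rewrite !val_psmod => /polyP/(_ i).
by rewrite !coef_poly ltnS si.
Qed.

Lemma ordt_psmod s f g : f != 0 -> g != 0 -> psmod s f = psmod s g ->
  (ordt f <= s)%N -> ordt g = ordt f.
Proof.
move=> /ordtP[fo flt] g0 /psmod_eqP fg os.
have [||//] := @ordt_eq g (ordt f); first by rewrite -fg.
by move=> i io; rewrite -fg ?flt // ltnW // (leq_trans io os).
Qed.

Lemma psmod_psXnM s m f : (s < m)%N -> psmod s (psXn m * f) = 0.
Proof.
move=> sm; rewrite -[RHS](linear0 (psmod s)); apply/psmod_eqP => i si.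
by rewrite coef_psXnM leqNgt (leq_ltn_trans si sm).
Qed.
End PowerSeriesOrder.

(** * Morphisms out of a monoid algebra *)

Section MonoidAlgebra.
Variables (S : nmodType) (K : comNzRingType).

Lemma sgalg_ind (P : sgalg S K -> Prop) :
  P 0 -> (forall f g, P f -> P g -> P (f + g)) ->
  (forall c u, P (c *: sgX K u)) -> forall g, P g.
Proof.
move=> P0 PD PX g; rewrite (monalgE g); elim/big_ind: _ => // u _.
by have := PX (g@_u : K) u; rewrite /sgX sgscaleU mulr1.
Qed.

(** The universal property of the monoid algebra. *)
Lemma sgalg_lift (A : comAlgType K) (phi : S -> A) :
  phi 0 = 1 -> {morph phi : u v / u + v >-> u * v} ->
  exists h : {lrmorphism sgalg S K -> A}, forall u, h (sgX K u) = phi u.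
Proof.
move=> phi0 phiD.
pose ext (g : sgalg S K) : A := \sum_(u <- msupp g) g@_u *: phi u.
have extw (D : {fset S}) (g : {malg K[S]}) : fsubset (msupp g) D ->
    ext g = \sum_(u <- D) g@_u *: phi u.
  move=> gD; rewrite /ext (big_fset_incl _ gD) // => u _ /mcoeff_outdom ->.
  by rewrite scale0r.
have ext_lin : linear ext.
  move=> a f g.
  (* A common support, on which the three sums can be compared termwise. *)
  pose D := (msupp (a *: (f : {malg K[S]}) + g) `|` (msupp f `|` msupp g))%fset.
  rewrite (@extw D (a *: (f : {malg K[S]}) + g)) ?fsubsetUl //.
  rewrite (@extw D f); last by rewrite /D fsetUA fsetUAC fsubsetUr.
  rewrite (@extw D g); last by rewrite /D fsetUA fsubsetUr.
  rewrite scaler_sumr -big_split /=; apply: eq_bigr => u _.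
  by rewrite mcoeffD mcoeffZ scalerDl scalerA.
pose L := GRing.isLinear.Build K (sgalg S K) A _ ext ext_lin.
have [hl hlE] : exists hl : {linear sgalg S K -> A}, hl = ext :> (_ -> _).
  by pose hl : {linear sgalg S K -> A} := HB.pack ext L; exists hl.
have extX u : hl (sgX K u) = phi u.
  rewrite hlE (extw [fset u]%fset) ?msuppU_le // big_seq_fset1 mcoeffUU.
  by rewrite scale1r.
have ext_mon : monoid_morphism ext.
  rewrite -hlE; split=> [|f g]; first by rewrite -sgX0 extX.
  elim/sgalg_ind: f => [|f1 f2 IH1 IH2|c u].
  - by rewrite mul0r linear0 mul0r.
  - by rewrite mulrDl !linearD /= IH1 IH2 mulrDl.
  elim/sgalg_ind: g => [|g1 g2 IH1 IH2|b v].
  - by rewrite mulr0 linear0 mulr0.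
  - by rewrite mulrDr !linearD /= IH1 IH2 mulrDr.
  rewrite -scalerAl -scalerAr !linearZ /= -sgXD !extX phiD.
  by rewrite -scalerAl -scalerAr.
pose M := GRing.isMonoidMorphism.Build (sgalg S K) A ext ext_mon.
pose h : {lrmorphism sgalg S K -> A} := HB.pack ext L M.
by exists h => u; rewrite -extX hlE.
Qed.

(** Bundled morphisms carry proofs, so the equality of the underlying functions
    has to be completed by proof irrelevance. *)
Lemma lrmorphism_eq (A : comAlgType K) (h h' : {lrmorphism sgalg S K -> A}) :
  (forall u, h (sgX K u) = h' (sgX K u)) -> h = h'.
Proof.
move=> hX; have hh' : h =1 h'.
  elim/sgalg_ind => [|f g IHf IHg|c u]; first by rewrite !linear0.
    by rewrite !linearD /= IHf IHg.
  by rewrite !linearZ /= hX.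
move/funext: hh'; case: h {hX} => f [[a] [b] [c]].
case: h' => g [[a'] [b'] [c']] /= fg.
case: _ / fg in a' b' c' *.
by congr (GRing.LRMorphism.Pack (GRing.LRMorphism.Class _ _ _));
  [ congr Algebra.isNmodMorphism.Axioms_
  | congr GRing.isMonoidMorphism.Axioms_
  | congr GRing.isScalable.Axioms_ ]; exact: Prop_irrelevance.
Qed.
End MonoidAlgebra.

(** * The pairing, and its sign on the cone *)

Lemma pairing0 (K : pzRingType) d (nu : 'cV[K]_d) : pairing nu 0 = 0.
Proof. by rewrite /pairing mul0mx mxE. Qed.

Lemma pairingD (K : pzRingType) d (nu : 'cV[K]_d) :
  {morph pairing nu : u v / u + v}.
Proof. by move=> u v; rewrite /pairing mulmxDl mxE. Qed.

Lemma pairingZ (K : pzRingType) d (nu : 'cV[K]_d) a u :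
  pairing nu (a *: u) = a * pairing nu u.
Proof. by rewrite /pairing -scalemxAl mxE. Qed.

Lemma pairing_sum (K : pzRingType) d (nu : 'cV[K]_d) (I : Type) (r : seq I) F :
  pairing nu (\sum_(i <- r) F i) = \sum_(i <- r) pairing nu (F i).
Proof. exact: (big_morph _ (pairingD nu) (pairing0 nu)). Qed.

Lemma pairing_map (K L : pzRingType) (f : {rmorphism K -> L}) d
    (nu : 'cV[K]_d) (u : 'rV[K]_d) :
  pairing (map_mx f nu) (map_mx f u) = f (pairing nu u).
Proof. by rewrite /pairing -map_mxM mxE. Qed.

Section Semigroups.
Variables (R : realType) (d n : nat) (Lam : addrClosed 'rV[int]_d).
Variable e : 'I_n -> 'rV[int]_d.
Hypothesis gen : generated_by Lam e [set: 'I_n]%SET.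

Lemma generator_mem i : e i \in Lam.
Proof.
apply/gen; exists (fun j => (j == i) : nat).
rewrite (bigD1 i) ?inE //= eqxx big1 ?addr0 ?mulr1n // => j /andP[_ /negPf ->].
by rewrite mulr0n.
Qed.

Definition generator i : semigroup Lam :=
  @Defs.Semigroup d Lam (e i) (generator_mem i).

Lemma semigroup_ind_gen (P : semigroup Lam -> Prop) :
  P 0 -> (forall u v, P u -> P v -> P (u + v)) ->
  (forall i, P (generator i)) -> forall u, P u.
Proof.
move=> P0 PD Pe u; have [c uE] := (gen u).1 (semigroup_valP u).
have -> : u = \sum_i generator i *+ c i.
  apply/val_inj; rewrite [LHS]uE raddf_sum.
  by apply: eq_big => i; rewrite ?inE // raddfMn.
elim/big_ind: _ => // i _; elim: (c i) => [|m IH]; first by rewrite mulr0n.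
by rewrite mulrS; apply: PD.
Qed.

Lemma cone_of_semigroup (u : semigroup Lam) : cone_of Lam R (toReal R u).
Proof.
exists 1%N, (fun=> 1), (fun=> u); split=> [_|]; first exact: ler01.
by rewrite big_ord1 scale1r.
Qed.

Lemma cone_of0 : cone_of Lam R 0.
Proof.
exists 0%N, (fun=> 0), (fun=> 0); split=> [_|]; first exact: lexx.
by rewrite big_ord0.
Qed.

Lemma pairing_cone_ge0 (nu : 'cV[R]_d) :
  (forall u : semigroup Lam, 0 <= pairing nu (toReal R u)) ->
  forall x, cone_of Lam R x -> 0 <= pairing nu x.
Proof.
move=> nu0 _ [m [c [u [c0 ->]]]]; rewrite pairing_sum.
by apply: sumr_ge0 => i _; rewrite pairingZ mulr_ge0.
Qed.

Lemma interior_ge0 (nu : 'cV[int]_d) (u : semigroup Lam) :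
  sigma_interior_lattice Lam R nu -> 0 <= pairing nu u.
Proof.
move=> /interior_subset/(_ _ (cone_of_semigroup u)).
by rewrite pairing_map ler0z.
Qed.

(** An interior form stays nonnegative on [u] after subtracting a small positive
    multiple of the form that takes the value [|u|^2] on [u]. *)
Lemma interior_gt0 (nu : 'cV[int]_d) (u : semigroup Lam) :
  sigma_interior_lattice Lam R nu -> (u : 'rV[int]_d) != 0 -> 0 < pairing nu u.
Proof.
move=> /nbhs_ballP[eps /= eps0 nb] u0.
(* The sum of the absolute values bounds each entry, and the added 1 makes the
   denominator positive and the bound strict. *)
pose x := toReal R u; pose del := eps / (\sum_j `|x 0 j| + 1).
have sx : 0 <= \sum_j `|x 0 j| by apply: sumr_ge0.
have sx1 : 0 < \sum_j `|x 0 j| + 1 by rewrite ltr_wpDl.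
have del0 : 0 < del by rewrite divr_gt0.
have /nb/(_ _ (cone_of_semigroup u)) :
    ball (toReal R nu) eps (toReal R nu - del *: x^T).
  split=> // j z; rewrite /ball /= !mxE opprB addrC subrK ord1.
  rewrite normrM (gtr0_norm del0) /del mulrAC ltr_pdivrMr // ltr_pM2l //.
  rewrite ltr_pwDr // (bigD1 j) //= mxE lerDl sumr_ge0 //.
rewrite -/x.
have -> : pairing (toReal R nu - del *: x^T) x =
    (pairing nu u)%:~R - del * \sum_j x 0 j ^+ 2.
  rewrite -pairing_map /pairing mulmxBr mxE; congr (_ + _).
  rewrite -scalemxAr !mxE; congr (- (_ * _)); apply: eq_bigr => j _.
  by rewrite !mxE expr2.
rewrite subr_ge0 -(ltr0z R); apply: lt_le_trans.
rewrite mulr_gt0 //.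
have [j uj] : exists j, (u : 'rV[int]_d) 0 j != 0.
  apply/existsP; apply: contraNT u0; rewrite negb_exists => /forallP u0.
  by apply/eqP/rowP => j; have := u0 j; rewrite negbK mxE => /eqP.
rewrite (bigD1 j) //= ltr_wpDr ?sumr_ge0 // => [i _|]; first exact: sqr_ge0.
by rewrite exprn_even_gt0 //= /x mxE intr_eq0.
Qed.
End Semigroups.

(** * Jets of toric arcs *)

Definition agree_upto (I : Type) (w w' : I -> int) (s : int) :=
  forall i, (w i <= s) || (w' i <= s) -> w i = w' i.

Lemma agree_upto_sym (I : Type) (w w' : I -> int) s :
  agree_upto w w' s -> agree_upto w' w s.
Proof. by move=> agr i; rewrite orbC => /agr. Qed.

Section Jets.
Variables (R : realType) (d n : nat) (Lam : addrClosed 'rV[int]_d).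
Variable e : 'I_n -> 'rV[int]_d.
Hypothesis gen : generated_by Lam e [set: 'I_n]%SET.
Implicit Types (nu : 'cV[int]_d) (u v : semigroup Lam).

Lemma arc_of_units nu (eta : semigroup Lam -> {powser R[i]}) :
  (forall u, 0 <= pairing nu u) ->
  eta 0 = 1 -> {morph eta : u v / u + v >-> u * v} ->
  (forall u, pscoef (eta u) 0 != 0) ->
  exists2 h, Hstar R Lam nu h &
    forall u, h (sgX _ u) = psXn _ `|pairing nu u|%N * eta u.
Proof.
move=> nu0 eta0 etaD etau.
pose m u := `|pairing nu u|%N.
have mE u : (m u)%:Z = pairing nu u by rewrite gez0_abs.
have [|u v|h hX] :=
  @sgalg_lift _ R[i] {powser R[i]} (fun u => psXn _ (m u) * eta u).
- by rewrite eta0 mulr1 /m pairing0 psXn0.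
- have -> : m (u + v) = (m u + m v)%N.
    by apply/eqP; rewrite -eqz_nat PoszD !mE -pairingD.
  by rewrite psXnD etaD mulrACA.
exists h => // u; rewrite hX -mE.
by have [-> ->] := ordt_psXnM (m u) (etau u).
Qed.

(** The units [X^u / t^<nu, u>] inherit multiplicativity from the arc, because
    power series of the form [t^m] can be cancelled. *)
Lemma units_of_arc nu (h : toric_arc R Lam) : Hstar R Lam nu h ->
  exists eta : semigroup Lam -> {powser R[i]},
  [/\ eta 0 = 1, {morph eta : u v / u + v >-> u * v},
      forall u, pscoef (eta u) 0 != 0 &
      forall u, h (sgX _ u) = psXn _ `|pairing nu u|%N * eta u].
Proof.
move=> hnu; pose m u := `|pairing nu u|%N.
have om u : ordt (h (sgX _ u)) = m u by rewrite /m; have [_ <-] := hnu u.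
have mE u : (m u)%:Z = pairing nu u by rewrite -om; have [] := hnu u.
have mD u v : m (u + v) = (m u + m v)%N.
  by apply/eqP; rewrite -eqz_nat PoszD !mE -pairingD.
pose eta u := psdrop (m u) (h (sgX _ u)).
have hE u : h (sgX _ u) = psXn _ (m u) * eta u.
  by rewrite /eta -om psXn_psdrop //; have [] := hnu u.
exists eta; split=> [|u v|u|//].
- have m0 : m 0 = 0%N by rewrite /m pairing0.
  by have := hE 0; rewrite m0 psXn0 mul1r sgX0 rmorph1.
- apply: (can_inj (@psXnK _ (m (u + v)))); rewrite -(hE (u + v)).
  have -> : h (sgX _ (u + v)) = h (sgX _ u) * h (sgX _ v).
    by rewrite sgXD rmorphM.
  by rewrite mD psXnD mulrACA -(hE u) -(hE v).
by rewrite /eta -om; have [/ordtP[]] := hnu u.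
Qed.

Lemma Hstar_neq0 nu : sigma_interior_lattice Lam R nu -> Hstar R Lam nu !=set0.
Proof.
move=> nuI; have [||||h hnu _] := @arc_of_units nu (fun=> 1); last by exists h.
- by move=> u; apply: interior_ge0 nuI.
- by [].
- by move=> u v; rewrite mulr1.
- by move=> u; rewrite oner_neq0.
Qed.

Lemma jet_of_arcE s (h : toric_arc R Lam) u :
  jet_of_arc Lam s h (sgX _ u) = psmod s (h (sgX _ u)).
Proof. by []. Qed.

(** The new arc keeps the units of the old one and changes only the powers of
    [t]; a generator whose power changes has order larger than [s] along both
    arcs, so its jets are zero. *)
Lemma jets_sub nu nu' s : sigma_interior_lattice Lam R nu' ->
  agree_upto (fun i => pairing nu (e i)) (fun i => pairing nu' (e i)) s%:Z ->
  (forall u, 0 <= pairing nu u) ->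
  jet_of_arc Lam s @` Hstar R Lam nu `<=` jet_of_arc Lam s @` Hstar R Lam nu'.
Proof.
move=> nuI' agr nu0 _ [h hnu <-].
have nu0' u : 0 <= pairing nu' u by apply: interior_ge0 nuI'.
have [eta [eta0 etaD etau hE]] := units_of_arc hnu.
have [h' hnu' hE'] := arc_of_units nu0' eta0 etaD etau.
exists h' => //; apply: lrmorphism_eq.
(* Jets are algebra morphisms, so generators suffice. *)
elim/(semigroup_ind_gen (gen := gen)) => [|u v IHu IHv|i].
- by rewrite sgX0 !rmorph1.
- by rewrite !sgXD !rmorphM; congr (_ * _); [exact: IHu|exact: IHv].
 rewrite !jet_of_arcE hE hE' /=.
have [/agr <-//|] :=
  boolP ((pairing nu (e i) <= s%:Z) || (pairing nu' (e i) <= s%:Z)).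
rewrite negb_or -!ltNge => /andP[lt lt'].
have abs_gt mu : s%:Z < pairing mu (e i) -> (s < `|pairing mu (e i)|)%N.
  by move=> smu; rewrite -ltz_nat gez0_abs // (le_trans _ (ltW smu)).
by rewrite !psmod_psXnM ?abs_gt.
Qed.

Lemma agree_of_jets nu nu' s (h h' : toric_arc R Lam) :
  Hstar R Lam nu h -> Hstar R Lam nu' h' ->
  jet_of_arc Lam s h = jet_of_arc Lam s h' ->
  agree_upto (fun i => pairing nu (e i)) (fun i => pairing nu' (e i)) s%:Z.
Proof.
move=> hnu hnu' jE i.
have [h0 hE] := hnu (generator gen i).
have [h0' hE'] := hnu' (generator gen i).
have psE : psmod s (h (sgX _ (generator gen i))) =
    psmod s (h' (sgX _ (generator gen i))).
  by rewrite -!jet_of_arcE jE.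
rewrite -[e i]/(generator gen i : 'rV[int]_d) -hE -hE' !lez_nat.
by case/orP => [/(ordt_psmod h0 h0' psE)->|/(ordt_psmod h0' h0 (esym psE))->].
Qed.
End Jets.

(** * Orders of the Newton polyhedra *)

Section Newton.
Variables (R : realType) (d n : nat) (Lam : addrClosed 'rV[int]_d).
Variable e : 'I_n -> 'rV[int]_d.
Implicit Types (f g : seq 'I_n).

Let v i := toRat (e i).

Lemma sum_pairing nu f :
  pairing (toReal R nu) (toReal R (\sum_(i <- f) e i)) =
  (\sum_(i <- f) pairing nu (e i))%:~R.
Proof. by rewrite pairing_map -pairing_sum. Qed.

(** Independent families without an order on the indices are easier to exchange;
    sorting recovers the increasing indexing. *)
Lemma JsetP k w :
  Jset e k w <-> exists f, [/\ indep v f, size f = k & w = \sum_(i <- f) e i].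
Proof.
split=> [[i [_ wi ->]]|[f [ff sf ->]]].
  exists (map i (enum 'I_k)); split.
  - by rewrite /indep -map_comp -wedge_free.
  - by rewrite size_map size_enum_ord.
  - by rewrite big_map big_enum.
pose f' := sort (fun i j : 'I_n => i <= j)%N f.
have pf : perm_eq f' f by rewrite perm_sort.
have sf' : size f' = k by rewrite (perm_size pf).
have ltf' : sorted (fun i j : 'I_n => i < j)%N f'.
  have: sorted ltn (map val f').
    rewrite ltn_sorted_uniq_leq (map_inj_uniq val_inj) (perm_uniq pf).
    rewrite (map_uniq (free_uniq ff)) /= sorted_map.
    by apply: sort_sorted => i j; apply: leq_total.
  by rewrite sorted_map.
have tf : size f' == k by rewrite sf'.
pose i := tnth (Tuple tf).
have iE : map i (enum 'I_k) = f' by rewrite map_tnth_enum.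
exists i; split.
- move=> a b ab; rewrite /i !(tnth_nth (i a)) /=.
  by rewrite (sorted_ltn_nth _ _ ltf') ?inE ?sf' //; apply: ltn_trans.
- rewrite wedge_free; rewrite (map_comp v i) iE.
  by rewrite -/(indep v f') /indep (perm_free (perm_map v pf)).
- by rewrite -(perm_big _ pf) /= -iE big_map big_enum.
Qed.

Lemma newton_J k f : indep v f -> size f = k ->
  newton Lam e k (toReal R (\sum_(i <- f) e i)).
Proof.
move=> ff sf C [_ JC]; apply: JC.
exists (toReal R (\sum_(i <- f) e i)), 0; split; last by rewrite addr0.
  by exists (\sum_(i <- f) e i) => //; apply/JsetP; exists f.
exact: cone_of0.
Qed.

(** A half-space is convex, so it contains the hull as soon as it contains the
    generating points and its linear part is nonnegative on the cone. *)
Lemma newton_halfspace k (nu : 'cV[R]_d) c :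
  (forall f, indep v f -> size f = k ->
     c <= pairing nu (toReal R (\sum_(i <- f) e i))) ->
  (forall u : semigroup Lam, 0 <= pairing nu (toReal R u)) ->
  forall x, newton Lam e k x -> c <= pairing nu x.
Proof.
move=> cJ nu0; apply: smallest_sub => [x y t|_ [x [y [[w Jw <-] yc ->]]]].
  rewrite !inE /= => cx cy.
  change (c <= pairing nu
    (t%:num *: (x : 'rV[R]_d) + (1 - t%:num) *: (y : 'rV[R]_d))).
  rewrite pairingD !pairingZ.
  rewrite -[c]mul1r -[X in X * c](subrKC t%:num 1) mulrDl.
  by apply: lerD; rewrite ler_wpM2l // subr_ge0.
have /JsetP[f [ff sf ->]] := Jw.
rewrite /= pairingD -[c]addr0 lerD ?cJ //.
exact: pairing_cone_ge0 yc.
Qed.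

Lemma ordJ_eq nu k g :
  sigma_interior_lattice Lam R nu ->
  greedy v (fun i => pairing nu (e i)) g -> size g = k ->
  ordJ Lam e k (toReal R nu) = (\sum_(i <- g) pairing nu (e i))%:~R.
Proof.
move=> nuI gg sg; set m := _%:~R.
have lbm : lbound [set pairing (toReal R nu) x | x in newton Lam e k] m.
  move=> _ [x Nx <-]; apply: newton_halfspace Nx => [f ff sf|u].
    by rewrite sum_pairing ler_int; apply: (greedy_min gg ff); rewrite sf sg.
  by rewrite pairing_map ler0z; apply: interior_ge0 nuI.
have inm : [set pairing (toReal R nu) x | x in newton Lam e k] m.
  exists (toReal R (\sum_(i <- g) e i)); last exact: sum_pairing.
  exact: newton_J (greedy_indep gg) sg.
apply/eqP; rewrite eq_le; apply/andP; split.
  by apply: ge_inf inm; exists m.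
by apply: lb_le_inf lbm; exists m.
Qed.
End Newton.

(** * The subspaces spanned by the generators *)

Section LatticePoints.
Variables (d : nat) (V : {vspace 'rV[rat]_d}).

(** A subgroup of the lattice, to which the generation hypothesis applies. *)
Definition lattice_points : {pred 'rV[int]_d} := [pred u | toRat u \in V].

Lemma lattice_points_closed : zmod_closed lattice_points.
Proof.
split=> [|u v]; first by rewrite inE /toRat map_mx0 mem0v.
by rewrite !inE /toRat map_mxB; apply: rpredB.
Qed.

HB.instance Definition _ :=
  GRing.isZmodClosed.Build 'rV[int]_d lattice_points lattice_points_closed.

Lemma lattice_points_full : (forall u, u \in lattice_points) -> \dim V = d.
Proof.
move=> full; have /eqP-> : V == fullv.
  rewrite eqEsubv subvf; apply/subvP => x _; rewrite (row_sum_delta x).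
  apply: rpred_sum => j _; apply: rpredZ.
  by have := full (delta_mx 0 j); rewrite inE /toRat map_delta_mx.
by rewrite dimvf /dim /= mul1n.
Qed.
End LatticePoints.

(** * Comparison of two linear forms *)

Section LogJacobian.
Variables (R : realType) (d n : nat) (Lam : addrClosed 'rV[int]_d).
Variable e : 'I_n -> 'rV[int]_d.
Hypothesis gen : generated_by Lam e [set: 'I_n]%SET.
Implicit Types (nu : 'cV[int]_d) (f g : seq 'I_n).

Let v i := toRat (e i).
Let w nu i := pairing nu (e i).

Lemma generators_span :
  generates_lattice Lam -> \dim (spanned v (enum 'I_n)) = d.
Proof.
move=> lat; apply: lattice_points_full; apply: lat => u /gen[c ->].
apply: rpred_sum => i _; apply: rpredMn.
by rewrite inE; apply: memv_span; apply: map_f; rewrite mem_enum.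
Qed.

(** The lower bound on [s] says that the last, hence heaviest, greedy choice has
    weight at most [s].  If a generator [i] of weight at most [s] were not
    spanned by the [k] choices, adding it would give [phi k.+1 nu <= s]. *)
Lemma Aset_greedy nu s k g : (1 <= k <= d)%N -> Aset R Lam e k (nu, s) ->
  greedy v (w nu) g -> size g = k ->
  {in g, forall i, w nu i <= s%:Z} /\
  forall i, w nu i <= s%:Z -> v i \in spanned v g.
Proof.
move=> /andP[k0 kd] [/= nuI _ phik phik1] gg sg; split.
  case: g gg sg => [|i g] gg sg //.
  have wi : w nu i <= s%:Z.
    rewrite -(ler_int R) -lee_fin; apply: le_trans phik.
    rewrite /phi ltn_eqF ?ltnS //.
    have [_ _ gg'] := gg; have sg' : size g = k.-1 by rewrite -sg.
    have ordk := ordJ_eq nuI gg sg; have ordk1 := ordJ_eq nuI gg' sg'.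
    case: eqP => [k1|_].
      have g0 : g = [::] by apply: size0nil; rewrite sg' k1.
      by move: ordk; rewrite k1 g0 big_seq1 => ->.
    by rewrite ordk ordk1 big_cons intrD addrK.
  move=> j; rewrite inE => /predU1P[->//|gj].
  exact: le_trans (greedy_head_max gg gj) wi.
move=> i wi; apply/negP => /negP gi.
have fi : indep v (i :: g) by rewrite indep_cons gi (greedy_indep gg).
(* Thus the value of [phi] at [k.+1] is finite. *)
have kd' : (k < d)%N.
  have := dimvS (subvf (spanned v (i :: g))).
  by rewrite (dim_spanned fi) /= sg dimvf /dim /= mul1n.
have [g' gg' sg'] : exists2 g', greedy v (w nu) g' & size g' = k.+1.
  apply: exists_greedy.
  rewrite -sg -[(size g).+1]/(size (i :: g)) -(dim_spanned fi).
  apply/dimvS/sub_span => _ /mapP[j _ ->].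
  by apply: map_f; rewrite mem_enum.
move: phik1; rewrite /phi eqSS ltn_eqF // eqSS gtn_eqF //= lte_fin.
rewrite (ordJ_eq nuI gg' sg') (ordJ_eq nuI gg sg) -intrB pmulrn ltr_int.
rewrite ltNge lerBlDr => /negP; apply.
have := greedy_min gg' fi; rewrite big_cons /= sg sg' => /(_ erefl) le_fi.
by apply: le_trans le_fi _; rewrite lerD2r.
Qed.

Lemma ell_greedy nu s k g : (1 <= k <= d)%N -> Aset R Lam e k (nu, s) ->
  greedy v (w nu) g -> size g = k -> ell e nu s = spanned v g.
Proof.
move=> kd A gg sg; have [gs sp] := Aset_greedy kd A gg sg.
apply: subv_anti; apply/andP; split.
  apply/span_subvP => _ /mapP[i + ->].
  by rewrite mem_filter => /andP[/sp + _].
apply/sub_span => _ /mapP[i gi ->]; apply: (map_f v).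
by rewrite mem_filter mem_enum gs.
Qed.

Lemma equivA_ell nu nu' s k : generates_lattice Lam -> (1 <= k <= d)%N ->
  Aset R Lam e k (nu, s) -> Aset R Lam e k (nu', s) ->
  equivA R Lam e k (nu, s) (nu', s) ->
  ell e nu s = ell e nu' s /\
  {in ell e nu s, pairing (toRat nu) =1 pairing (toRat nu')}.
Proof.
move=> lat kd A A' [_ /= eqv].
have kspan : (k <= \dim (spanned v (enum 'I_n)))%N.
  by rewrite generators_span //; case/andP: kd.
have [g gg sg] := exists_greedy (w nu) kspan.
have [g' gg' sg'] := exists_greedy (w nu') kspan.
have [gs _] := Aset_greedy kd A gg sg.
have ww' : {in g, w nu =1 w nu'}.
  apply: eq_in_of_sum_drop => j.
  have [jk|kj] := ltnP j k; last by rewrite drop_oversize ?sg // !big_nil.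
  have ggj := greedy_drop j gg; have sgj : size (drop j g) = (k - j)%N.
    by rewrite size_drop sg.
  have [|faceE ordE] := eqv (k - j)%N; first by rewrite subn_gt0 jk leq_subr.
  have [nuI _ _ _] := A.
  have ordj := ordJ_eq nuI ggj sgj.
  have : face Lam e (k - j) (toReal R nu)
      (toReal R (\sum_(i <- drop j g) e i)).
    split; last by rewrite sum_pairing ordj.
    exact: newton_J (greedy_indep ggj) sgj.
  rewrite faceE => -[_]; rewrite sum_pairing -ordE ordj => /eqP.
  by rewrite eqr_int => /eqP.
have ellE := ell_greedy kd A gg sg; have ellE' := ell_greedy kd A' gg' sg'.
split.
  apply/eqP; rewrite eqEdim ellE {2}ellE' (dim_spanned (greedy_indep gg)).
  rewrite (dim_spanned (greedy_indep gg')) sg sg' leqnn andbT.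
  apply/sub_span => _ /mapP[i gi ->].
  by apply: (map_f v); rewrite mem_filter mem_enum -/(w nu' i) -ww' // gs.
move=> x; rewrite ellE => /(coord_span (X := in_tuple (map v g))) ->.
rewrite !pairing_sum; apply: eq_bigr => j _; rewrite !pairingZ; congr (_ * _).
have jg : (j < size g)%N by rewrite -(size_map v) ltn_ord.
have i0 : 'I_n := tnth (in_tuple g) (Ordinal jg).
rewrite (nth_map i0) // !pairing_map; congr (_ %:~R).
by apply: ww'; rewrite mem_nth.
Qed.

Lemma ell_agree nu nu' s :
  ell e nu s = ell e nu' s ->
  {in ell e nu s, pairing (toRat nu) =1 pairing (toRat nu')} ->
  agree_upto (w nu) (w nu') s%:Z.
Proof.
move=> ellE nuE i wi; apply: (@intr_inj rat).
rewrite -!(pairing_map intr); apply: nuE.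
have mem mu : w mu i <= s%:Z -> v i \in ell e mu s.
  move=> mus; apply: memv_span; apply: (map_f v).
  by rewrite mem_filter mem_enum andbT.
by case/orP: wi => /mem; rewrite ?ellE.
Qed.

(** With [m] the common value of the orders and [C] the sum of all weights for
    [nu'], the inequality [C * (<nu, x> - m) >= <nu', x> - m] holds on the whole
    Newton polyhedron, which settles the inclusion of faces at once.  On a sum
    of [j] independent generators, either it is minimal for [nu], hence for
    [nu'], and both sides vanish, or by integrality [<nu, x> - m >= 1], while
    [<nu', x> <= C].  On a nonzero generator of the cone [nu] is at least 1 and
    [nu'] at most [C]. *)
Lemma face_sub_of_agree nu nu' s j g g' :
  sigma_interior_lattice Lam R nu -> sigma_interior_lattice Lam R nu' ->
  agree_upto (w nu) (w nu') s%:Z ->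
  greedy v (w nu) g -> size g = j -> {in g, forall i, w nu i <= s%:Z} ->
  greedy v (w nu') g' -> size g' = j -> {in g', forall i, w nu' i <= s%:Z} ->
  ordJ Lam e j (toReal R nu) = ordJ Lam e j (toReal R nu') /\
  face Lam e j (toReal R nu) `<=` face Lam e j (toReal R nu').
Proof.
move=> nuI nuI' agr gg sg gs gg' sg' gs'.
have ordE := ordJ_eq nuI gg sg; have ordE' := ordJ_eq nuI' gg' sg'.
have sum_agree f : {in f, forall i, w nu i <= s%:Z} ->
    \sum_(i <- f) w nu i = \sum_(i <- f) w nu' i.
  move=> fs; rewrite !big_seq; apply: eq_bigr => i fi.
  by apply: agr; rewrite fs.
have sgg' : \sum_(i <- g) w nu i = \sum_(i <- g') w nu' i.
  apply/eqP; rewrite eq_le; apply/andP; split; last first.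
    rewrite (sum_agree g gs).
    by apply: greedy_min (greedy_indep gg) _; rewrite ?sg ?sg'.
  have <- : \sum_(i <- g') w nu i = \sum_(i <- g') w nu' i.
    rewrite !big_seq; apply: eq_bigr => i gi.
    by apply: agr; rewrite (gs' i gi) orbT.
  by apply: greedy_min (greedy_indep gg') _; rewrite ?sg ?sg'.
have ordEE : ordJ Lam e j (toReal R nu) = ordJ Lam e j (toReal R nu').
  by rewrite ordE ordE' sgg'.
split=> // x [Nx xE]; split=> //.
set m := \sum_(i <- g) w nu i in ordE sgg'.
pose C := \sum_i w nu' i.
have w0' i : 0 <= w nu' i by exact: interior_ge0 (generator gen i) nuI'.
have w0 i : 0 <= w nu i by exact: interior_ge0 (generator gen i) nuI.
have C0 : 0 <= C by apply: sumr_ge0.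
have cone_le (u : semigroup Lam) : 0 <= pairing (C *: nu - nu') u.
  elim/(semigroup_ind_gen (gen := gen)): u => [|u1 u2 IH1 IH2|i].
  - by rewrite pairing0.
  - by rewrite /= pairingD addr_ge0.
  rewrite [semigroup_val _]/=.
  have [->|ei0] := eqVneq (e i) 0; first by rewrite pairing0.
  have wi : 0 < w nu i by apply: (@interior_gt0 R _ _ nu (generator gen i)).
  have -> : pairing (C *: nu - nu') (e i) = C * w nu i - w nu' i.
    by rewrite /w /pairing mulmxBr -scalemxAr !mxE.
  rewrite subr_ge0; apply: le_trans (ler_peMr C0 _); last by rewrite -gtz0_ge1.
  by rewrite /C (bigD1 i) //= lerDl sumr_ge0.
have : (C * m - m)%:~R <= pairing (toReal R (C *: nu - nu')) x.
  apply: newton_halfspace Nx => [f ff sf|u]; last by rewrite pairing_map ler0z.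
  rewrite sum_pairing ler_int.
  have -> : \sum_(i <- f) pairing (C *: nu - nu') (e i) =
      C * \sum_(i <- f) w nu i - \sum_(i <- f) w nu' i.
    rewrite mulr_sumr -sumrB; apply: eq_bigr => i _.
    by rewrite /w /pairing mulmxBr -scalemxAr !mxE.
  have mf : m <= \sum_(i <- f) w nu i.
    by apply: (greedy_min gg ff); rewrite sf sg.
  have [fm|fm] := eqVneq (\sum_(i <- f) w nu i) m.
    rewrite -(sum_agree f) ?fm //.
    by apply: (greedy_min_bound gg gs ff) => //; rewrite sf sg.
  have fm1 : m + 1 <= \sum_(i <- f) w nu i by rewrite lezD1 lt_neqAle eq_sym fm.
  have fC : \sum_(i <- f) w nu' i <= C.
    rewrite /C big_uniq ?(map_uniq (free_uniq ff)) //=.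
    by rewrite [leRHS](bigID (mem f)) /= lerDl sumr_ge0.
  have m0 : 0 <= m by apply: sumr_ge0.
  have : C * (m + 1) <= C * \sum_(i <- f) w nu i by rewrite ler_wpM2l.
  rewrite mulrDr mulr1; lia.
have -> : pairing (toReal R (C *: nu - nu')) x =
    C%:~R * pairing (toReal R nu) x - pairing (toReal R nu') x.
  rewrite /pairing /toReal map_mxB map_mxZ mulmxBr -scalemxAr.
  by rewrite !mxE.
rewrite xE ordE intrB intrM lerD2l lerN2 => xm.
apply/eqP; rewrite eq_le -ordEE ordE xm /=.
rewrite -ordE ordEE ordE'; apply: newton_halfspace Nx => [f ff sf|u].
  by rewrite sum_pairing ler_int; apply: (greedy_min gg' ff); rewrite sf sg'.
by rewrite pairing_map ler0z; apply: interior_ge0 nuI'.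
Qed.

Lemma agree_equivA nu nu' s k : generates_lattice Lam -> (1 <= k <= d)%N ->
  Aset R Lam e k (nu, s) -> Aset R Lam e k (nu', s) ->
  agree_upto (w nu) (w nu') s%:Z ->
  equivA R Lam e k (nu, s) (nu', s).
Proof.
move=> lat kd A A' agr; split=> //= j /andP[j0 jk].
have kspan : (k <= \dim (spanned v (enum 'I_n)))%N.
  by rewrite generators_span //; case/andP: kd.
have minimizers mu : Aset R Lam e k (mu, s) -> exists g,
    [/\ greedy v (w mu) g, size g = j & {in g, forall i, w mu i <= s%:Z}].
  move=> B; have [g gg sg] := exists_greedy (w mu) kspan.
  exists (drop (k - j) g); split; first exact: greedy_drop.
    by rewrite size_drop sg subKn.
  by have [gs _] := Aset_greedy kd B gg sg; move=> i /mem_drop/gs.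
have [g [gg sg gs]] := minimizers _ A.
have [g' [gg' sg' gs']] := minimizers _ A'.
have [nuI _ _ _] := A; have [nuI' _ _ _] := A'.
have [ordE fs] := face_sub_of_agree nuI nuI' agr gg sg gs gg' sg' gs'.
have agr' := agree_upto_sym agr.
have [_ fs'] := face_sub_of_agree nuI' nuI agr' gg' sg' gs' gg sg gs.
by split=> //; apply/seteqP.
Qed.
End LogJacobian.

Theorem proposition8p3 (R : realType) (d n k : nat)
    (Lam : addrClosed 'rV[int]_d) (e : 'I_n -> 'rV[int]_d)
    (nu nu' : 'cV[int]_d) (s : nat) :
  admissible_semigroup Lam R ->
  minimal_generators Lam e ->
  (1 <= k <= d)%N ->
  Aset R Lam e k (nu, s) ->
  Aset R Lam e k (nu', s) ->
  [<-> (* i *) equivA R Lam e k (nu, s) (nu', s);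
       (* ii *) ell e nu s = ell e nu' s /\
         {in ell e nu s, pairing (toRat nu) =1 pairing (toRat nu')};
       (* iii *) jet_of_arc Lam s @` Hstar R Lam nu =
         jet_of_arc Lam s @` Hstar R Lam nu';
       (* iv *) (jet_of_arc Lam s @` Hstar R Lam nu) `&`
         (jet_of_arc Lam s @` Hstar R Lam nu') !=set0].
Proof.
move=> [_ lat _ _] [gen _] kd A A'.
have [/= nuI _ _ _] := A; have [/= nuI' _ _ _] := A'.
tfae.
- exact: equivA_ell.
- case=> ellE nuE; have agr := ell_agree ellE nuE.
  apply/seteqP; split.
    by apply: (jets_sub gen nuI' agr) => u; apply: interior_ge0 nuI.
  have agr' := agree_upto_sym agr.
  by apply: (jets_sub gen nuI agr') => u; apply: interior_ge0 nuI'.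
- move=> jE; have [h hnu] := Hstar_neq0 nuI.
  by exists (jet_of_arc Lam s h); rewrite -jE setIid; exists h.
- case=> _ [[h hnu <-] [h' hnu' /esym jE]].
  exact: agree_equivA (agree_of_jets gen hnu hnu' jE).
Qed.
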